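(* For all $\mathbf{a}\in\Sigma$, any point of the solenoid $\sigma_{\mathbf{a}}$ admits a neighbourhood (in $\sigma_{\mathbf{a}}$) which is homeomorphic to the product of an interval and a Cantor set.
   Context: $\mathbb{N}=\{1,2,\dots\}$, $\mathbb{T}=\mathbb{R}/2\pi\mathbb{Z}$, and $\mathbb{T}^{\mathbb{N}}$ carries the product topology. $\Sigma$ is the set of sequences $\mathbf{a}=(a_j)_{j\in\mathbb{N}}$ of natural numbers with $a_1=1$ and $a_j>1$ for all $j>1$. For $\mathbf{a}\in\Sigma$ the solenoid is $\sigma_{\mathbf{a}}=\{\theta=(\Theta_j+2\pi\mathbb{Z})_{j\in\mathbb{N}}\in\mathbb{T}^{\mathbb{N}}:\Theta_j=a_{j+1}\Theta_{j+1}\bmod 2\pi\ \ \forall j\in\mathbb{N}\}$ with the subspace topology. ''Interval'' means the open interval $(0,1)$ with its standard topology; a Cantor set is a (non-empty, metrizable) compact, totally disconnected space in which every point is an accumulation point. *)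

(* Defs.v *)
From HB Require Import structures.
From mathcomp Require Import all_boot all_order all_algebra.
From mathcomp Require Import all_classical all_reals all_analysis.

Set Implicit Arguments.
Unset Strict Implicit.
Unset Printing Implicit Defensive.

Import Order.TTheory GRing.Theory Num.Theory.
Import numFieldTopology.Exports.

Local Open Scope classical_set_scope.
Local Open Scope ring_scope.
Local Open Scope quotient_scope.

Definition homeomorphic (X Y : topologicalType) : Prop :=
  exists (f : X -> Y) (g : Y -> X),
    [/\ cancel f g, cancel g f, continuous f & continuous g].

Definition metrizable (R : realType) (X : topologicalType) : Prop :=
  exists M : metricType R, homeomorphic X M.

(* [perfect_set setT] says that every point of X is an accumulation point. *)
Definition Cantor_set (R : realType) (X : topologicalType) : Prop :=
  [/\ [set: X] !=set0, metrizable R X, compact [set: X],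
      totally_disconnected [set: X] & perfect_set [set: X]].

Section circle.
Variable R : realType.

Definition eq_mod2pi (x y : R) : Prop :=
  exists k : int, x = y + k%:~R * (2 * pi).

Definition eq_mod2pib : rel R := fun x y => `[< eq_mod2pi x y >].

Lemma eq_mod2pib_refl : reflexive eq_mod2pib.
Proof. by move=> x; apply/asboolP; exists 0; rewrite mul0r addr0. Qed.

Lemma eq_mod2pib_sym : symmetric eq_mod2pib.
Proof.
move=> x y; apply/asboolP/asboolP => -[k ->]; exists (- k);
  by rewrite mulrNz mulNr addrK.
Qed.

Lemma eq_mod2pib_trans : transitive eq_mod2pib.
Proof.
move=> y x z /asboolP[k ->] /asboolP[l ->]; apply/asboolP; exists (l + k).
by rewrite rmorphD/= -addrA -mulrDl.
Qed.

Canonical eq_mod2pi_equiv : equiv_rel R :=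
  EquivRel eq_mod2pib eq_mod2pib_refl eq_mod2pib_sym eq_mod2pib_trans.

Definition circle : topologicalType :=
  quotient_topology {eq_quot eq_mod2pi_equiv}.

(* The class x + 2 pi Z. *)
Definition to_circle (x : R) : circle :=
  \pi_(quotient_topology {eq_quot eq_mod2pi_equiv}) x.

Lemma to_circle_eqP (x y : R) : to_circle x = to_circle y <-> eq_mod2pi x y.
Proof.
split=> [/eqmodP/asboolP//|xy].
by apply/eqmodP; apply/asboolP.
Qed.

Lemma to_circle_surj (t : circle) : exists x : R, t = to_circle x.
Proof. by exists (repr (t : {eq_quot eq_mod2pi_equiv})); rewrite /to_circle reprK. Qed.

End circle.

(* Indices are shifted by one: the index j : nat stands for the positive      *)
(* natural number j + 1, so a 0 is the first term of the sequence.            *)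
Definition Sigma_seq : set (nat -> nat) :=
  [set a | a 0%N = 1%N /\ forall j : nat, (0 < j)%N -> (1 < a j)%N].

Definition solenoid (R : realType) (a : nat -> nat) :
    set (prod_topology (fun _ : nat => circle R)) :=
  [set theta | exists Theta : nat -> R,
    (forall j : nat, theta j = to_circle (Theta j)) /\
    (forall j : nat, eq_mod2pi (Theta j) ((a j.+1)%:R * Theta j.+1))].

Arguments solenoid : clear implicits.

Definition open_unit_interval (R : realType) : set R := `]0, 1[%classic.

Arguments open_unit_interval : clear implicits.

(* Main.v *)
Require Import Defs.
From HB Require Import structures.
From mathcomp Require Import all_boot all_order all_algebra.
From mathcomp Require Import all_classical all_reals all_analysis.
From mathcomp Require Import zify ring lra.

Set Implicit Arguments.
Unset Strict Implicit.
Unset Printing Implicit Defensive.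

Import Order.TTheory GRing.Theory Num.Theory.
Import numFieldTopology.Exports.

Local Open Scope classical_set_scope.
Local Open Scope ring_scope.

(** The solenoid is locally an arc times a Cantor set because a point theta is
    determined by its first coordinate together with a sequence of digits.
    Measure angles in full turns, and let N_j = a_1 ... a_j be the degree
    of the j-th coordinate over the first one.  If theta_0 lifts to the real
    number v, then theta_j is one of the N_j roots (v + D) / N_j, with
    0 <= D < N_j.  Compatibility of consecutive coordinates says that
    D_(j+1) = D_j modulo N_j, so the sequence (D_j) is the same thing as a
    sequence of mixed-radix digits d_j < a_(j+1), with D_j = sum_(i < j) d_i N_i.
    The digits range over a product of finite discrete spaces with at least
    two points each, which is a Cantor set ([digits_Cantor_set]).

    The map (v, d) |-> theta is [chart].  On all of R x [digits a] it is
    continuous and onto, but winding once around the circle acts as an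
    odometer on the digits; restricting v to an open interval ]c, c + 1[ makes
    the lift of theta_0, hence also the digits, unique.  Its image there is the
    open set of points whose first coordinate lies on the corresponding arc.

    Continuity of the inverse uses a single coordinate at a time
    ([chart_inv_near]): since R -> circle is an open map, prescribing theta_j
    up to a small arc prescribes v + D_j up to a small interval modulo N_j.
    When v and v' lie in ]c, c + 1[ this fixes D_j exactly, because two numbers
    v + D and v' + D' with D, D' < N_j and |v - v'| < 1 agree modulo N_j only
    if v = v' and D = D' ([chart_inj_coord]); and D_j determines the first j
    digits. *)

(** * Maps into products *)

Lemma prod_topology_continuous (X : topologicalType) (I : Type)
    (T : I -> topologicalType) (f : X -> prod_topology T) :
  (forall i, continuous (fun x => f x i)) -> continuous f.
Proof.
move=> cf x; apply/cvg_sup => i U [V [[W oW <-] Wfx VU]].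
apply: filterS VU _; apply: (cf i x); exact: open_nbhs_nbhs.
Qed.

Lemma pair_continuous (X Y Z : topologicalType) (f : X -> Y) (g : X -> Z) :
  continuous f -> continuous g -> continuous (fun x => (f x, g x)).
Proof. by move=> cf cg x; exact: cvg_pair (cf x) (cg x). Qed.

(** * Hausdorff pseudometric spaces are metrizable *)

Section metrization.
Variable R : realType.
Variables (T : pseudoMetricType R) (hsT : hausdorff_space T).
Local Notation edist := (@edist R T).

(** A copy of T that can carry a metric structure whose balls differ from the
    given ones while inducing the same topology. *)
Definition metrized of hausdorff_space T : Type := T.

HB.instance Definition _ := Choice.copy (metrized hsT) T.

(** Truncation at 1 turns the extended distance into a real-valued one.  The
    given balls need not be open balls of any distance, whence the two separate
    comparisons [bdist_lt_ball] and [ball_bdist_le]. *)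
Definition bdist (x y : T) : R := fine (mine 1%E (edist (x, y))).

Lemma bdist_fin x y : mine 1%E (edist (x, y)) \is a fin_num.
Proof.
by rewrite ge0_fin_numE ?le_min ?lee01 ?edist_ge0// gt_min ltry.
Qed.

Lemma bdistE x y : ((bdist x y)%:E = mine 1 (edist (x, y)))%E.
Proof. by rewrite fineK// bdist_fin. Qed.

Lemma bdist_lt_ball x y e : bdist x y < e -> e <= 1 -> ball x e y.
Proof.
rewrite -lte_fin bdistE gt_min => /orP[|xye _]; last exact: (edist_lt_ball xye).
by rewrite lte_fin => /lt_le_trans h /h; rewrite ltxx.
Qed.

Lemma ball_bdist_le x y e : 0 < e -> ball x e y -> bdist x y <= e.
Proof.
move=> e0 xye; rewrite -lee_fin bdistE ge_min; apply/orP; right.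
exact: (@edist_fin _ _ _ (x, y)).
Qed.

Lemma bdistxx x : bdist x x = 0.
Proof. by rewrite /bdist edist_refl min_r ?lee01. Qed.

Lemma bdist_sym x y : bdist x y = bdist y x.
Proof. by rewrite /bdist edist_sym. Qed.

Lemma bdist_eq0 x y : bdist x y = 0 -> x = y.
Proof.
move=> xy0; apply: (close_eq hsT); apply/edist_closeP.
have := bdistE x y; rewrite xy0 /mine; case: ifPn => // _ [] /esym/eqP.
by rewrite oner_eq0.
Qed.

Lemma bdist_triangle y x z : bdist x z <= bdist x y + bdist y z.
Proof.
rewrite -lee_fin EFinD !bdistE.
have ge0 u v : (0 <= mine 1 (edist (u, v) : \bar R))%E.
  by rewrite le_min lee01 edist_ge0.
have [h1|h1] := leP 1%E (edist (x, y)).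
  by rewrite ge_min leeDl.
have [h2|h2] := leP 1%E (edist (y, z)).
  by rewrite ge_min leeDr.
by rewrite ge_min edist_triangle orbT.
Qed.

HB.instance Definition _ := @isMetric.Build R (metrized hsT)
  bdist bdistxx bdist_eq0 bdist_sym bdist_triangle.

Lemma hausdorff_metrizable : metrizable R T.
Proof.
exists (metrized hsT), (fun x => x), (fun x => x).
have ballE (x y : metrized hsT) e : ball x e y = (bdist x y < e).
  by rewrite ballEmdist.
split=> // x A /nbhs_ballP[e /= e0 xeA]; apply/nbhs_ballP.
  exists (e / 2); first exact: divr_gt0.
  move=> y xy; apply: xeA; rewrite ballE.
  by rewrite (le_lt_trans (ball_bdist_le _ xy)) ?divr_gt0 ?ltr_pdivrMr ?ltr_pMr ?ltr1n.
exists (Num.min e 1); first by rewrite /= lt_min e0 ltr01.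
move=> y; rewrite ballE => xy; apply: xeA.
by apply: (le_ball _ (bdist_lt_ball xy _)); rewrite ge_min lexx ?orbT.
Qed.

End metrization.

(** * Mixed-radix digits *)

Section digits.
Variable a : nat -> nat.

(** The degree of the j-th coordinate of the solenoid over the first one. *)
Definition scale (j : nat) : nat := \prod_(i < j) a i.+1.

Definition digits : Type :=
  prod_topology (fun j => discrete_topology 'I_(a j.+1)).

HB.instance Definition _ := Topological.on digits.

Definition partial_value (d : digits) (j : nat) : nat :=
  \sum_(i < j) (d i : 'I_(a i.+1)) * scale i.

Lemma scaleS j : scale j.+1 = (scale j * a j.+1)%N.
Proof. exact: big_ord_recr. Qed.

Lemma partial_valueS d j :
  partial_value d j.+1 = (partial_value d j + (d j : 'I_(a j.+1)) * scale j)%N.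
Proof. exact: big_ord_recr. Qed.

Lemma partial_value_lt d j : (partial_value d j < scale j)%N.
Proof.
elim: j => [|j IH]; first by rewrite /partial_value /scale !big_ord0.
rewrite partial_valueS scaleS; apply: (@leq_trans ((d j : 'I_(a j.+1)).+1 * scale j)).
  by rewrite mulSn ltn_add2r.
by rewrite mulnC leq_mul2l ltn_ord orbT.
Qed.

Lemma scale_gt0 : (forall j, (0 < a j.+1)%N) -> forall j, (0 < scale j)%N.
Proof. by move=> a_gt0 j; rewrite /scale prodn_gt0. Qed.

(** Euclidean division by [scale a j] recovers both the previous partial value
    and the last digit. *)
Lemma partial_value_digits (d d' : digits) j :
  partial_value d j = partial_value d' j ->
  forall i, (i < j)%N -> d i = d' i.
Proof.
elim: j => // j IH; rewrite !partial_valueS => eqS.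
have scale_gt0 : (0 < scale j)%N by exact: leq_trans (partial_value_lt d j).
have eqj : partial_value d j = partial_value d' j.
  have := congr1 (modn^~ (scale j)) eqS.
  by rewrite /= ![(partial_value _ _ + _)%N]addnC !modnMDl !modn_small
    ?partial_value_lt.
move=> i; rewrite ltnS leq_eqVlt => /predU1P[->|]; last exact: IH.
move/eqP: eqS; rewrite eqj eqn_add2l eqn_pmul2r// => /eqP; exact: val_inj.
Qed.

(** A compatible family of residues modulo the [scale a j] comes from digits:
    the j-th one is the quotient of K (j + 1) by [scale a j]. *)
Lemma digits_of (K : nat -> nat) : (forall j, (K j < scale j)%N) ->
  (forall j, K j.+1 = K j %[mod scale j]) ->
  exists d : digits, forall j, partial_value d j = K j.
Proof.
move=> Klt Kmod.
have digit_lt j : (K j.+1 %/ scale j < a j.+1)%N.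
  have scale_gt0 : (0 < scale j)%N by exact: leq_trans (Klt j).
  by rewrite ltn_divLR// mulnC -scaleS.
exists (fun j => Ordinal (digit_lt j)); elim=> [|j IH].
  rewrite /partial_value big_ord0; have := Klt 0%N.
  by rewrite /scale big_ord0 ltnS leqn0 => /eqP.
rewrite partial_valueS IH /= addnC [RHS](divn_eq _ (scale j)) Kmod.
by rewrite (modn_small (Klt j)).
Qed.

Lemma digit_near (d : digits) i : \forall d' \near d, d' i = d i.
Proof.
exact: (@proj_continuous nat (fun j => discrete_topology 'I_(a j.+1)) i d _
  (discrete_set1 _)).
Qed.

(** Only finitely many discrete digits enter a partial value. *)
Lemma partial_value_near (d : digits) j :
  \forall d' \near d, partial_value d' j = partial_value d j.
Proof.
elim: j => [|j IH]; first by near=> d'; rewrite /partial_value !big_ord0.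
near=> d'; rewrite !partial_valueS; congr (_ + _ * _)%N; near: d' => //.
by have := digit_near d j; apply: filterS => d' ->.
Unshelve. all: by end_near. Qed.

Lemma digits_Cantor_set (R : realType) :
  (forall j, (1 < a j.+1)%N) -> Cantor_set R digits.
Proof.
move=> a_gt1.
have a_gt0 j : (0 < a j.+1)%N by exact: ltnW.
have hs : hausdorff_space digits.
  by apply: hausdorff_product => j; exact: discrete_hausdorff.
have compact_digit j : compact [set: discrete_topology 'I_(a j.+1)].
  by apply: finite_compact; exact: (@finite_finset 'I_(a j.+1) setT).
split.
- by exists (fun j => Ordinal (a_gt0 j)).
- exact: (@hausdorff_metrizable R
    (prod_topology (fun j => discrete_topology 'I_(a j.+1))) hs).
- have := @tychonoff nat (fun j => discrete_topology 'I_(a j.+1))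
    (fun=> setT) compact_digit.
  by congr (compact _); rewrite eqEsubset.
- apply: zero_dimension_totally_disconnected.
  by apply: zero_dimension_prod => j; exact: discrete_zero_dimension.
- apply: (@perfect_diagonal (fun j => discrete_topology 'I_(a j.+1))) => j.
  by exists (Ordinal (a_gt0 j), Ordinal (a_gt1 j)).
Qed.

End digits.

(** * The covering of the circle by the line *)

Section circle_turns.
Variable R : realType.

(** Measuring angles in full turns keeps 2 pi out of the computations: the
    fibres of [turn] are the cosets of the integers. *)
Definition turn (x : R) : circle R := to_circle (x * (2 * pi)).

Let pi2_neq0 : 2 * pi != 0 :> R.
Proof. by rewrite mulf_neq0 ?pnatr_eq0// gt_eqF ?pi_gt0. Qed.

Lemma turn_eqP (x y : R) : turn x = turn y <-> exists k : int, x = y + k%:~R.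
Proof.
rewrite to_circle_eqP; split=> -[k xy]; exists k.
  by apply: (mulIf pi2_neq0); rewrite [RHS]mulrDl.
by rewrite xy [LHS]mulrDl.
Qed.

Lemma turn_surj (t : circle R) : exists x, t = turn x.
Proof.
by have [x ->] := to_circle_surj t; exists (x / (2 * pi)); rewrite /turn divfK.
Qed.

Lemma turn_continuous : continuous turn.
Proof.
have to_circle_continuous : continuous (@to_circle R) by exact: pi_continuous.
move=> x; apply: (@continuous_comp R R (circle R) ( *%R^~ (2 * pi))).
  exact: mulrr_continuous.
exact: to_circle_continuous.
Qed.

(** The saturation of an open set is the union of its integer translates. *)
Lemma turn_open (A : set R) : open A -> open (turn @` A).
Proof.
move=> oA.
change (open (@to_circle R @^-1` (turn @` A))).
have -> : @to_circle R @^-1` (turn @` A) =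
    \bigcup_(k : int) ((fun y => y / (2 * pi) - k%:~R) @^-1` A).
  apply/seteqP; split => y.
    move=> [x Ax xy].
    have /to_circle_eqP[k xyk] : to_circle (x * (2 * pi)) = to_circle y by [].
    exists (- k) => //=; rewrite rmorphN opprK.
    suff -> : y / (2 * pi) + k%:~R = x by [].
    by apply: (mulIf pi2_neq0); rewrite [LHS]mulrDl divfK.
  move=> [k _ /= Ayk]; exists (y / (2 * pi) - k%:~R) => //.
  apply/to_circle_eqP; exists (- k).
  by rewrite mulrBl divfK// rmorphN mulNr.
apply: bigcup_open => k _; apply: open_comp oA => y _.
apply: cvgB; last exact: cvg_cst.
exact: mulrr_continuous.
Qed.

End circle_turns.

(** * Local charts of the solenoid *)

Section solenoid_chart.
Variables (R : realType) (a : nat -> nat).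
Hypothesis a_gt0 : forall j, (0 < a j.+1)%N.

Let scale_neq0 j : (scale a j)%:R != 0 :> R.
Proof. by rewrite pnatr_eq0 -lt0n scale_gt0. Qed.

(** The point of the solenoid whose first coordinate is v turns and whose
    j-th coordinate is the root of index [partial_value d j]. *)
Definition chart (v : R) (d : digits a) :
    prod_topology (fun _ : nat => circle R) :=
  fun j => turn ((v + (partial_value d j)%:R) / (scale a j)%:R).

Lemma chart_solenoid v d : solenoid R a (chart v d).
Proof.
exists (fun j => (v + (partial_value d j)%:R) / (scale a j)%:R * (2 * pi)).
split=> // j; exists (- (nat_of_ord (d j))%:Z).
rewrite rmorphN /= partial_valueS scaleS natrD !natrM.
by field; rewrite scale_neq0 pnatr_eq0 -lt0n a_gt0.
Qed.

Lemma chart0 v d : chart v d 0%N = turn v.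
Proof. by rewrite /chart /partial_value /scale !big_ord0 addr0 divr1. Qed.

Lemma chart_continuous :
  continuous (fun p : R * digits a => chart p.1 p.2).
Proof.
apply: prod_topology_continuous => j.
have arg_continuous : continuous (fun p : R * digits a =>
    (p.1 + (partial_value p.2 j)%:R) / (scale a j)%:R : R).
  move=> p; apply: cvgMr_tmp; apply: cvgD; first exact: cvg_fst.
  apply: cvg_near_cst.
  exists (setT, [set d | partial_value d j = partial_value p.2 j]) => /=.
    by split; [exact: filterT|exact: partial_value_near].
  by move=> q [_ /= ->].
move=> p.
exact: (continuous_comp (arg_continuous p) (@turn_continuous R _)).
Qed.

(** The integer v - v' = D' - D + k N has absolute value less than 1, so it
    vanishes, and then D = D' modulo N with both residues reduced. *)
Lemma chart_inj_coord v v' d d' j : `|v - v'| < 1 ->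
  chart v d j = chart v' d' j ->
  v = v' /\ partial_value d j = partial_value d' j.
Proof.
move=> vv' /turn_eqP[k vdk].
pose D := partial_value d j; pose D' := partial_value d' j.
pose N := scale a j.
have vE : v - v' = (D'%:Z - D%:Z + k * N%:Z)%:~R.
  rewrite !rmorphD rmorphM /= rmorphN /=.
  have : v + D%:R = v' + D'%:R + k%:~R * N%:R.
    by rewrite -[LHS](divfK (scale_neq0 j)) vdk mulrDl divfK.
  by rewrite -!pmulrn; lra.
have DN : (D < N)%N by exact: partial_value_lt.
have D'N : (D' < N)%N by exact: partial_value_lt.
have m0 : D'%:Z - D%:Z + k * N%:Z = 0.
  by move: vv'; rewrite vE -intr_norm ltrz1; lia.
split; first by apply/eqP; rewrite -subr_eq0 vE m0.
have k0 : k = 0 by nia.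
by move: m0; rewrite k0; lia.
Qed.

(** Compatibility gives N_j y_j = v + m_j for an integer m_j, where y_j is a
    lift of theta_j; the residues of the m_j modulo N_j are compatible, hence
    are the partial values of a digit sequence. *)
Lemma chart_surj (v : R) (theta : prod_topology (fun _ : nat => circle R)) :
  solenoid R a theta -> theta 0%N = turn v -> exists d, theta = chart v d.
Proof.
move=> [angle [thetaE angle_mul]] theta0.
pose y j := angle j / (2 * pi).
have thetay j : theta j = turn (y j).
  by rewrite thetaE /turn divfK// mulf_neq0 ?pnatr_eq0// gt_eqF ?pi_gt0.
have y_mul j : exists k : int, y j = (a j.+1)%:R * y j.+1 + k%:~R.
  have [k angle_k] := angle_mul j; exists k; rewrite /y angle_k mulrDl mulrA.
  by rewrite mulfK// mulf_neq0 ?pnatr_eq0// gt_eqF ?pi_gt0.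
have y_scale j : exists m : int, (scale a j)%:R * y j = v + m%:~R.
  elim: j => [|j [m mE]].
    have : turn (y 0%N) = turn v by rewrite -thetay.
    by rewrite /scale big_ord0 mul1r => /turn_eqP.
  have [k kE] := y_mul j; exists (m - (scale a j)%:Z * k).
  rewrite scaleS natrM -mulrA rmorphB rmorphM /= addrA -mE kE.
  by rewrite mulrDr addrK.
have /choice[K KP] : forall j, exists K, (K < scale a j)%N /\
    exists q : int, y j = (v + K%:R) / (scale a j)%:R + q%:~R.
  move=> j.
  have [m mE] := y_scale j; have N_gt0 := scale_gt0 a_gt0 j.
  have N0 : (scale a j)%:Z != 0 by rewrite eqz_nat -lt0n.
  exists `|(m %% (scale a j)%:Z)%Z|%N; split.
    by rewrite -ltz_nat gez0_abs ?modz_ge0// ltz_pmod.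
  exists (m %/ (scale a j)%:Z)%Z.
  apply: (mulfI (scale_neq0 j)); rewrite mE mulrDr mulrCA divff// mulr1.
  rewrite -[in RHS]addrA; congr (v + _).
  rewrite [in LHS](divz_eq m (scale a j)%:Z) rmorphD rmorphM /= addrC mulrC.
  by rewrite natr_absz ger0_norm ?modz_ge0.
have Kmod j : K j.+1 = K j %[mod scale a j].
  have [_ [q qE]] := KP j; have [_ [q' q'E]] := KP j.+1.
  have [k kE] := y_mul j.
  have KE : (K j.+1)%:Z = (q - (a j.+1)%:Z * q' - k) * (scale a j)%:Z + (K j)%:Z.
    apply/eqP; rewrite -(eqr_int R) !rmorphD rmorphM !rmorphB rmorphM /=.
    rewrite -!pmulrn; apply/eqP.
    have e : v + (K j)%:R + (scale a j)%:R * q%:~R = v + (K j.+1)%:R +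
        (scale a j)%:R * ((a j.+1)%:R * q'%:~R + k%:~R).
      transitivity ((scale a j)%:R * y j).
        by rewrite qE mulrDr mulrCA divff// mulr1.
      rewrite kE q'E scaleS natrM; field.
      by rewrite scale_neq0 pnatr_eq0 -lt0n a_gt0.
    lra.
  apply/eqP; rewrite -eqz_nat -!modz_nat KE; apply/eqP; exact: modzMDl.
have [d dE] := digits_of (fun j => proj1 (KP j)) Kmod.
exists d; apply: functional_extensionality_dep => j.
rewrite thetay /chart dE; have [_ [q ->]] := KP j.
by apply/turn_eqP; exists q.
Qed.

(** Local continuity of the inverse chart, without choosing an inverse: the
    points whose j-th coordinate lies on a small arc around that of [chart v d]
    have their lift in A and agree with d on the first j digits. *)
Lemma chart_inv_near c v d (A : set R) j : open A -> A v -> c < v < c + 1 ->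
  \forall theta \near chart v d, forall v' d', c < v' < c + 1 ->
    theta = chart v' d' -> A v' /\ forall i, (i < j)%N -> d' i = d i.
Proof.
move=> oA Av cv.
(* If y is a lift of the j-th coordinate of a point with the same first j
   digits as d, then [lift y] is a lift of its first coordinate. *)
pose lift (y : R) := y * (scale a j)%:R - (partial_value d j)%:R : R.
pose arc := @turn R @` (lift @^-1` (A `&` `]c, c + 1[)).
have arc_open : open arc.
  apply: turn_open; apply: open_comp => [y _|]; last exact: openI.
  by apply: cvgB; [exact: mulrr_continuous|exact: cvg_cst].
have near_arc : \forall theta \near chart v d, arc (theta j).
  apply: (@proj_continuous nat (fun=> circle R) j).
  apply: open_nbhs_nbhs; split => //.
  exists ((v + (partial_value d j)%:R) / (scale a j)%:R) => //=.
  by rewrite /lift divfK// addrK; split => //=; rewrite in_itv.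
have FF : Filter (nbhs (chart v d)).
  exact: (@nbhs_filter (prod_topology (fun=> circle R)) (chart v d)).
apply: filterS near_arc => theta [y [Ay]] /=; rewrite in_itv /= => cy ytheta.
move=> v' d' cv' thetaE.
have yE : chart (lift y) d j = chart v' d' j.
  by rewrite -thetaE -ytheta /chart /lift subrK mulfK.
have [yv' dd'] : lift y = v' /\ partial_value d j = partial_value d' j.
  by apply: chart_inj_coord yE; rewrite ltr_norml; lra.
by split; [rewrite -yv'|exact: partial_value_digits].
Qed.

Definition solenoid_arc (c : R) : set (solenoid R a) :=
  [set theta | exists v, c < v < c + 1 /\ \val theta 0%N = turn v].

Lemma solenoid_arc_nbhs c v (theta : solenoid R a) :
  c < v < c + 1 -> \val theta 0%N = turn v -> nbhs theta (solenoid_arc c).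
Proof.
move=> cv theta0.
pose arc := @turn R @` `]c, c + 1[.
have near_arc : nbhs (\val theta 0%N) arc.
  apply: open_nbhs_nbhs; split; first exact: turn_open.
  by exists v => //=; rewrite in_itv.
have near_val : nbhs theta [set th | arc (\val th 0%N)].
  exact: (@initial_continuous _ _ (@set_val _ (solenoid R a)) theta _
    (@proj_continuous nat (fun=> circle R) 0%N (\val theta) _ near_arc)).
apply: filterS near_val => th [w /=]; rewrite in_itv /= => cw wth.
by exists w; split.
Qed.

Lemma chart_inj c v v' d d' : c < v < c + 1 -> c < v' < c + 1 ->
  chart v d = chart v' d' -> v = v' /\ d = d'.
Proof.
move=> cv cv' vdE.
have coord j : v = v' /\ partial_value d j = partial_value d' j.
  by apply: chart_inj_coord; rewrite ?vdE// ltr_norml; lra.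
split; first by have [] := coord 0%N.
apply: functional_extensionality_dep => i.
exact: (partial_value_digits (proj2 (coord i.+1))).
Qed.

(** The parameter s in the unit interval stands for the lift v = c + s. *)
Lemma solenoid_arc_homeomorphic c :
  homeomorphic (solenoid_arc c) (open_unit_interval R * digits a)%type.
Proof.
have shift_itv (s : open_unit_interval R) : c < c + \val s < c + 1.
  by have := set_valP s; rewrite /open_unit_interval /= in_itv /=; lra.
have unit_itv v : c < v < c + 1 -> (v - c) \in open_unit_interval R.
  by rewrite inE /open_unit_interval /= in_itv /=; lra.
have chart_mem p : chart p.1 p.2 \in solenoid R a.
  by apply/mem_set; exact: chart_solenoid.
pose to_solenoid (p : R * digits a) : solenoid R a := SigSub (chart_mem p).
have arc_mem (p : open_unit_interval R * digits a) :
    to_solenoid (c + \val p.1, p.2) \in solenoid_arc c.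
  by apply/mem_set; exists (c + \val p.1); split=> //; exact: chart0.
pose g p : solenoid_arc c := SigSub (arc_mem p).
have g_surj (u : solenoid_arc c) : exists p, u = g p.
  have [v [cv u0]] := set_valP u.
  have [d dE] := chart_surj (set_valP (\val u)) u0.
  exists (SigSub (unit_itv v cv), d); do 2 apply: val_inj => /=.
  by rewrite dE; congr chart; rewrite addrC subrK.
have [f fE] := choice g_surj.
have g_inj : injective g.
  move=> [s d] [s' d'] /(congr1 (fun u => \val (\val u))) /=.
  move=> /(chart_inj (shift_itv s) (shift_itv s')) [/addrI ss' ->].
  by congr pair; exact: val_inj.
have chart_f u : \val (\val u) = chart (c + \val (f u).1) (f u).2.
  by rewrite {1}(fE u).
have f_near u (A : set R) j : nbhs (\val (f u).1) A ->
    \forall w \near u, A (\val (f w).1) /\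
      forall i, (i < j)%N -> (f w).2 i = (f u).2 i.
  rewrite nbhsE => -[B [oB Bu] BA].
  have oBc : open ((fun v => v - c) @^-1` B).
    apply: open_comp oB => v _; apply: cvgB; [exact: cvg_id|exact: cvg_cst].
  have Buc : ((fun v => v - c) @^-1` B) (c + \val (f u).1) by rewrite /= addrC addKr.
  have := chart_inv_near (f u).2 j oBc Buc (shift_itv (f u).1).
  rewrite -chart_f => near_val.
  have near_u : \forall w \near u, forall v d, c < v < c + 1 ->
      \val (\val w) = chart v d ->
      B (v - c) /\ forall i, (i < j)%N -> d i = (f u).2 i.
    exact: (@initial_continuous _ _ (@set_val _ (solenoid_arc c)) u _
      (@initial_continuous _ _ (@set_val _ (solenoid R a)) (\val u) _ near_val)).
  apply: filterS near_u => w /(_ _ _ (shift_itv (f w).1) (chart_f w))[Bw fw].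
  by split=> //; apply: BA; rewrite addrC addKr in Bw.
exists f, g; split.
- by move=> u.
- by move=> p; apply: g_inj; rewrite -fE.
- have f1_continuous : continuous (fun u => (f u).1).
    apply: continuous_comp_initial => u A Au.
    by have := f_near u A 0%N Au; apply: filterS => w [].
  have f2_continuous : continuous (fun u => (f u).2).
    apply: prod_topology_continuous => i u A Au.
    have near_digit : \forall w \near u, (f w).2 i = (f u).2 i.
      by apply: filterS (f_near u setT i.+1 filterT) => w [_]; apply.
    apply: (@filterS _ (nbhs u) _ _ _ _ near_digit) => w /= ->.
    exact: nbhs_singleton.
  have -> : f = fun u => ((f u).1, (f u).2) by apply/funext => w; case: (f w).
  exact: pair_continuous f1_continuous f2_continuous.
- apply: continuous_comp_initial; apply: continuous_comp_initial.
  have shift_continuous : continuous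
      (fun p : open_unit_interval R * digits a => (c + \val p.1, p.2)).
    apply: pair_continuous => p; last exact: cvg_snd.
    apply: cvgD; first exact: cvg_cst.
    apply: (@continuous_comp _ _ _ fst (@set_val _ (open_unit_interval R))).
      exact: cvg_fst.
    exact: initial_continuous.
  move=> p.
  exact: (continuous_comp (shift_continuous p) (@chart_continuous _)).
Qed.

End solenoid_chart.

Theorem proposition4p8 (R : realType) (a : nat -> nat) (ha : Sigma_seq a)
    (x : solenoid R a) :
  exists U : set (solenoid R a), nbhs x U /\
    exists C : topologicalType, Cantor_set R C /\
      homeomorphic U (open_unit_interval R * C)%type.
Proof.
have a_gt1 j : (1 < a j.+1)%N by case: ha => _; apply.
have a_gt0 j : (0 < a j.+1)%N by exact: ltnW.
have [v xv] := turn_surj (\val x 0%N).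
exists (solenoid_arc (v - 2^-1)); split.
  by apply: (solenoid_arc_nbhs _ xv); lra.
exists (digits a); split; first exact: digits_Cantor_set.
exact: solenoid_arc_homeomorphic.
Qed.
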